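(* Let $k,s\ge1$ be fixed integers. Then there is a constant $K>0$ (depending only on $k$ and $s$) such that for all integers $n\ge k$, $$N_s^{d_{FS}}(k,n)\;\le\;\left[\prod_{j=1}^{2s}\frac{(j-1)!}{(j+k-1)!}\right]n^{2ks}+K\,n^{2ks-1}.$$
   Context: $\mathrm{Gr}(k,n)$ is the set of $k$-dimensional linear subspaces of $\mathbb{R}^n$. The Fubini–Study distance is $d_{FS}(\mathbb{U},\mathbb{V})=\arccos|\det(U^{T}V)|$, where $U,V\in\mathbb{R}^{n\times k}$ have columns forming orthonormal bases of $\mathbb{U},\mathbb{V}$ respectively (independent of the choice of bases). For a function $\delta:\mathrm{Gr}(k,n)\times\mathrm{Gr}(k,n)\to\mathbb{R}$, a finite subset $S\subseteq\mathrm{Gr}(k,n)$ is an $s$-distance set with respect to $\delta$ if $|\{\delta(\mathbb{U},\mathbb{V}):\mathbb{U}\ne\mathbb{V},\ \mathbb{U},\mathbb{V}\in S\}|\le s$; $N_s^{\delta}(k,n)$ is the maximum cardinality of such a set. *)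

(* Defs.v *)
From HB Require Import structures.
From mathcomp Require Import all_boot all_order all_algebra.
From mathcomp Require Import finmap.
From mathcomp Require Import all_classical all_reals all_analysis.

Set Implicit Arguments.
Unset Strict Implicit.
Unset Printing Implicit Defensive.

Import Order.TTheory GRing.Theory Num.Theory.

Local Open Scope ring_scope.

Definition Gr (R : realType) (k n : nat) : Type :=
  {U : {vspace 'cV[R]_n} | \dim U == k}.

HB.instance Definition _ (R : realType) (k n : nat) :=
  Choice.copy (Gr R k n) {U : {vspace 'cV[R]_n} | \dim U == k}.

Definition orthonormal_basis (R : realType) (k n : nat)
    (U : {vspace 'cV[R]_n}) (A : 'M[R]_(n, k)) : Prop :=
  basis_of U [seq col i A | i : 'I_k] /\ A^T *m A = 1%:M.

Definition onb (R : realType) (k n : nat) (U : Gr R k n) : 'M[R]_(n, k) :=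
  xget 0 (orthonormal_basis (val U)).

(* The choice of bases made by [onb] is irrelevant: see [dFSE] below. *)
Definition dFS (R : realType) (k n : nat) (U V : Gr R k n) : R :=
  acos `|\det ((onb U)^T *m onb V)|.

Definition s_distance_set (R : realType) (k n s : nat)
    (delta : Gr R k n -> Gr R k n -> R) (S : {fset Gr R k n}) : Prop :=
  (#|` [fset delta U V | U in S, V in S & U != V]%fset| <= s)%N.

(* The maximum is taken as a supremum in the extended reals, so that an upper
   bound by a real number includes the fact that the cardinalities are bounded
   (and then the supremum is attained). *)
Definition Nmax (R : realType) (k n s : nat)
    (delta : Gr R k n -> Gr R k n -> R) : \bar R :=
  ereal_sup [set ((#|` S|%fset)%:R)%:E | S in s_distance_set s delta]%classic.

Section OrthonormalBases.
Variables (R : realType) (n : nat).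

Lemma mul_mx_col_sum k (A : 'M[R]_(n, k)) (c : 'cV[R]_k) :
  A *m c = \sum_i c i 0 *: col i A.
Proof.
apply/matrixP => i j; rewrite (ord1 j) !mxE summxE.
by apply: eq_bigr => l _; rewrite !mxE mulrC.
Qed.

Lemma orthonormal_basisP k (U : {vspace 'cV[R]_n}) (A : 'M[R]_(n, k)) :
  \dim U = k -> (forall i, col i A \in U) -> A^T *m A = 1%:M ->
  orthonormal_basis U A.
Proof.
move=> dU AU AA; split=> //.
have sz : size [seq col i A | i : 'I_k] = k by rewrite size_map size_enum_ord.
rewrite basisEfree sz dU leqnn andbT; apply/andP; split; last first.
  by apply/span_subvP => x /mapP[i _ ->].
have -> : [seq col i A | i : 'I_k] = [tuple col i A | i < k] by [].
apply/freeP => c c0 i.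
have : A *m (\col_i c i) = 0.
  rewrite mul_mx_col_sum -[RHS]c0; apply: eq_bigr => j _.
  by rewrite mxE -tnth_nth tnth_mktuple.
move/(congr1 (mulmx A^T)); rewrite mulmxA AA mul1mx mulmx0.
by move/matrixP/(_ i 0); rewrite !mxE.
Qed.

Lemma ex_orthonormal_basis k (U : {vspace 'cV[R]_n}) :
  \dim U = k -> exists A : 'M[R]_(n, k), orthonormal_basis U A.
Proof.
elim: k U => [|k IH] U dU.
  by exists 0; apply: orthonormal_basisP => // [[]|] //; apply/matrixP => [[]].
have [t bt] : exists t : k.+1.-tuple 'cV[R]_n, basis_of U t.
  by rewrite -dU; exists (vbasis U); apply: vbasisP.
case/tupleP: t bt => u X bU.
have := basis_free bU; rewrite free_cons => /andP[uX fX].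
have sXU : (<<X>> <= U)%VS.
  by apply/span_subvP => x Xx; apply: (basis_mem bU); rewrite in_cons Xx orbT.
have uU : u \in U by apply: (basis_mem bU); rewrite mem_head.
have dX : \dim <<X>> = k by rewrite (eqP fX) size_tuple.
have [A [bA AA]] := IH _ dX.
have AX i : col i A \in <<X>>%VS.
  by apply: (basis_mem bA); apply/mapP; exists i; rewrite ?mem_enum.
pose w := u - A *m (A^T *m u).
have wX : A *m (A^T *m u) \in <<X>>%VS.
  by rewrite mul_mx_col_sum memv_suml // => i _; rewrite memvZ.
have wU : w \in U by rewrite memvB // (subvP sXU).
have Aw : A^T *m w = 0 by rewrite mulmxBr !mulmxA AA mul1mx subrr.
have w0 : w != 0 by apply: contraNneq uX => /subr0_eq ->.
have ww : 0 < (w^T *m w) 0 0.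
  rewrite mxE lt_neqAle sumr_ge0 ?andbT; last first.
    by move=> i _; rewrite mxE -expr2 sqr_ge0.
  rewrite eq_sym; apply: contra w0; rewrite psumr_eq0; last first.
    by move=> i _; rewrite mxE -expr2 sqr_ge0.
  move/allP => h; apply/eqP/matrixP => i j; rewrite (ord1 j) [RHS]mxE.
  by have := h i (mem_index_enum i); rewrite /= mxE mulf_eq0 orbb => /eqP.
pose a := (Num.sqrt ((w^T *m w) 0 0))^-1.
have aww : (a *: w)^T *m (a *: w) = 1%:M.
  have -> : (a *: w)^T = a *: w^T by apply/matrixP => i j; rewrite !mxE.
  rewrite -scalemxAl -scalemxAr scalerA -expr2 exprVn sqr_sqrtr ?ltW //.
  by rewrite {2}[w^T *m w]mx11_scalar scale_scalar_mx mulVf ?gt_eqF.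
exists (row_mx (a *: w) A : 'M[R]_(n, 1 + k)).
apply: orthonormal_basisP => //.
  move=> i; rewrite -[i](@splitK 1 k); case: (fintype.split _) => j /=.
    by rewrite (@colKl _ n 1 k) (ord1 j) col_id memvZ.
  by rewrite (@colKr _ n 1 k) (subvP sXU).
rewrite (@tr_row_mx _ n 1 k) (@mul_col_row _ 1 k n 1 k) aww AA.
have -> : (a *: w)^T = a *: w^T by apply/matrixP => i j; rewrite !mxE.
rewrite -scalemxAr Aw scaler0 -scalemxAl -[w^T *m A]trmxK trmx_mul trmxK Aw.
by rewrite trmx0 scaler0 -scalar_mx_block.
Qed.

Lemma onbP k (U : Gr R k n) : orthonormal_basis (val U) (onb U).
Proof. by apply: xgetPex; apply: ex_orthonormal_basis; apply/eqP/(valP U). Qed.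

Lemma orthonormal_basis_det k (U : {vspace 'cV[R]_n}) (A B : 'M[R]_(n, k)) :
  orthonormal_basis U A -> orthonormal_basis U B ->
  exists2 P : 'M[R]_k, `|\det P| = 1 & B = A *m P.
Proof.
move=> [bA AA] [bB BB].
have eB : B = A *m (A^T *m B).
  suff h (v : 'cV[R]_n) : v \in U -> A *m (A^T *m v) = v.
    apply/matrixP => i j.
    have Bj : col j B \in U.
      by apply: (basis_mem bB); apply/mapP; exists j; rewrite ?mem_enum.
    have := h _ Bj; rewrite colE !mulmxA -!colE => /matrixP/(_ i 0).
    by rewrite ![col j _ i 0]mxE => ->.
  move=> vU.
  have := @coord_basis _ _ U k [tuple col i A | i < k] v bA vU.
  move=> hv.
  have -> : v = A *m (\col_i coord [tuple col i A | i < k] i v).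
    rewrite [LHS]hv mul_mx_col_sum; apply: eq_bigr => i _.
    by rewrite mxE -tnth_nth tnth_mktuple.
  by rewrite [A^T *m _]mulmxA AA mul1mx.
exists (A^T *m B) => //.
have : (A^T *m B)^T *m (A^T *m B) = 1%:M.
  by rewrite trmx_mul trmxK -mulmxA -eB BB.
move/(congr1 determinant); rewrite det_mulmx det_tr det1 -expr2 => /eqP.
by rewrite sqrf_eq1 => /orP[]/eqP ->; rewrite ?normrN normr1.
Qed.

Lemma dFSE k (U V : Gr R k n) (A B : 'M[R]_(n, k)) :
  orthonormal_basis (val U) A -> orthonormal_basis (val V) B ->
  dFS U V = acos `|\det (A^T *m B)|.
Proof.
move=> oA oB; rewrite /dFS.
have [P dP ->] := orthonormal_basis_det oA (onbP U).
have [Q dQ ->] := orthonormal_basis_det oB (onbP V).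
rewrite trmx_mul mulmxA -(mulmxA P^T) !det_mulmx det_tr !normrM dP dQ.
by rewrite mul1r mulr1.
Qed.

End OrthonormalBases.

(* Main.v *)
Require Import Defs.
From mathcomp Require Import all_boot all_order all_algebra.
From mathcomp Require Import perm.
From mathcomp Require Import finmap.
From mathcomp Require Import all_classical all_reals all_analysis.
From mathcomp Require Import ring lra zify.
Set Implicit Arguments.
Unset Strict Implicit.
Unset Printing Implicit Defensive.
Import Order.TTheory GRing.Theory Num.Theory.
Local Open Scope ring_scope.

(** The proof is the polynomial method in a homogeneous form.  Let [S] be an
    [s]-distance set, let [tau_1, ..., tau_s] be the squared cosines of its
    distances, padded if there are fewer than [s] of them, and attach to each
    [V] in [S] the function of the frame [U]
      [f_V (U) = \prod_i (\det (U^T V)^2 - tau_i \det (U^T U))].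
    On orthonormal frames of members of [S] it vanishes unless [U] spans the
    same space as [V], where it is nonzero because no [tau_i] is [1]: equality
    in the Cauchy-Schwarz inequality for Plücker vectors forces equality of
    the subspaces ([det_onb_eq1]).  So the [f_V] are linearly independent, and
    [S] is bounded by the dimension of a space that contains them.  By the
    Cauchy-Binet formula they all lie in the span of the products of [m = 2s]
    maximal minors of [U] ([annihilator_expand]).

    A product of minors is a multilinear form in [N = m k] rows of [U], that is,
    a tensor on words of length [N] over [k] letters evaluated at a choice of
    [N] rows.  Sorting the rows costs a permutation of the positions of the
    words, so a combination of products of minors is determined by one tensor
    for each multiset of [N] rows, and there are ['C(N + n - 1, N)] multisets.
    Each of these tensors is [SL_k]-invariant; only two consequences of this
    matter: it is killed by the operators that replace a letter [j.+1] by [j],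
    and it is supported on words that contain each letter [m] times.  In other
    words it is a highest weight vector of rectangular weight, and such a
    vector vanishes as soon as it vanishes on all lattice words
    ([highest_determined]).  Hence
      [#|S| <= 'C(N + n - 1, N) * #lattice words] ([card_separated_points]).

    The number of lattice words is [N!] times the Frobenius determinant
    [\det (1 / (L_i - j)!)], where [L_i = l_i + i], as both satisfy the same
    recursion ([size_lattice_words]); for a rectangle the determinant is
    evaluated by Vandermonde convolution ([det_inv_fact_rect]) and gives the
    constant of the theorem.  Finally [N! 'C(N + n - 1, N)] is the rising
    factorial [n (n + 1) ... (n + N - 1) = n^N + O(n^(N - 1))]. *)

(** * Highest weight vectors and lattice words *)

Section HighestWeight.
Variables (R : realFieldType) (k : nat).
Implicit Types (c d f : seq nat -> R) (w : seq nat) (l : nat -> nat).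

(** Words are sequences of natural numbers, so that a tensor of order [N.+1] is
    sliced into tensors of order [N] by fixing the first letter; all statements
    are relative to the words of the given length over the letters below [k]. *)
Definition is_word N w := (size w == N) && all (fun a => a < k)%N w.

Fixpoint sum_words N f : R :=
  if N is N'.+1 then \sum_(a < k) sum_words N' (fun w => f (val a :: w))
  else f [::].

(** [lower j] and [raise j] are the Chevalley generators of [gl_k] attached to
    the letters [j] and [j.+1], acting on the [N]-th tensor power of the
    standard representation: [lower j c w] sums [c] over the words obtained
    from [w] by turning one letter [j.+1] into [j]. *)
Fixpoint lower j c w : R :=
  if w is a :: w' then
    lower j (fun v => c (a :: v)) w' + (if a == j.+1 then c (j :: w') else 0)
  else 0.

Fixpoint raise j c w : R :=
  if w is a :: w' then
    raise j (fun v => c (a :: v)) w' + (if a == j then c (j.+1 :: w') else 0)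
  else 0.

Lemma sum_wordsD N f1 f2 :
  sum_words N (fun w => f1 w + f2 w) = sum_words N f1 + sum_words N f2.
Proof.
elim: N f1 f2 => //= N IH f1 f2; rewrite -big_split /=.
by apply: eq_bigr => a _; rewrite IH.
Qed.

Lemma sum_wordsZ N (x : R) f : sum_words N (fun w => x * f w) = x * sum_words N f.
Proof.
by elim: N f => //= N IH f; rewrite big_distrr; apply: eq_bigr => a _; rewrite IH.
Qed.

Lemma eq_sum_words N f1 f2 : f1 =1 f2 -> sum_words N f1 = sum_words N f2.
Proof.
elim: N f1 f2 => [|N IH] f1 f2 e //=.
by apply: eq_bigr => a _; apply: IH => w.
Qed.

Lemma sum_words_ge0 N f : (forall w, 0 <= f w) -> 0 <= sum_words N f.
Proof. by elim: N f => //= N IH f f0; apply: sumr_ge0 => a _; apply: IH. Qed.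

Lemma sum_words_eq0 N f w :
  (forall w, 0 <= f w) -> sum_words N f = 0 -> is_word N w -> f w = 0.
Proof.
elim: N f w => [|N IH] f w f0; first by move=> /= f0' /andP[/nilP ->].
case: w => [|a w] //= s0 /andP[sw /= /andP[ak aw]].
have /allP/(_ (Ordinal ak)) : all (fun a : 'I_k => (true ==>
    (sum_words N (fun w => f (val a :: w)) == 0))) (index_enum 'I_k).
  by rewrite -psumr_eq0 ?s0 // => b _; apply: sum_words_ge0.
rewrite mem_index_enum => /(_ isT)/= /eqP sa.
by apply: (IH (fun w => f (a :: w))) => //; apply/andP.
Qed.

Lemma sum_ord_delta m (F : nat -> R) : (m < k)%N ->
  \sum_(a < k) (if val a == m then F a else 0) = F m.
Proof. by move=> mk; rewrite -big_mkcond /= big_ord1_eq mk. Qed.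

Lemma sum_words_if N (b : bool) f :
  sum_words N (fun w => if b then f w else 0) = if b then sum_words N f else 0.
Proof.
case: b => //; rewrite -[RHS](mul0r (sum_words N f)) -sum_wordsZ.
by apply: eq_sum_words => w; rewrite mul0r.
Qed.

Lemma lower_adjoint j N c d : (j.+1 < k)%N ->
  sum_words N (fun w => lower j c w * d w) =
  sum_words N (fun w => c w * raise j d w).
Proof.
move=> jk; elim: N c d => [|N IH] c d /=; first by rewrite mul0r mulr0.
pose F a := sum_words N (fun w => c (j :: w) * d (a :: w)).
pose G a := sum_words N (fun w => c (a :: w) * d (j.+1 :: w)).
transitivity (\sum_(a < k)
    sum_words N (fun w => lower j (fun v => c (val a :: v)) w * d (val a :: w))
  + sum_words N (fun w => c (j :: w) * d (j.+1 :: w))).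
  rewrite -[X in _ = _ + X]/(F j.+1) -(sum_ord_delta F jk).
  rewrite -big_split; apply: eq_bigr => a _ /=; rewrite -sum_words_if -sum_wordsD.
  by apply: eq_sum_words => w; case: ifP => _; rewrite mulrDl ?mul0r.
rewrite -[X in _ + X]/(G j) -(sum_ord_delta G (ltnW jk)).
rewrite -big_split; apply: eq_bigr => a _ /=; rewrite -sum_words_if IH -sum_wordsD.
by apply: eq_sum_words => w; case: ifP => _; rewrite mulrDr ?mulr0.
Qed.

(** This is the commutation relation of [sl_2] in integrated form: [raise j] is
    the adjoint of [lower j], and their commutator acts on a word by the
    difference of the multiplicities of [j] and [j.+1]. *)
Lemma lower_raise_norm j N c : (j.+1 < k)%N ->
  sum_words N (fun w => lower j c w ^+ 2) =
  sum_words N (fun w => raise j c w ^+ 2)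
  + sum_words N (fun w => ((count_mem j w)%:R - (count_mem j.+1 w)%:R) * c w ^+ 2).
Proof.
move=> jk; elim: N c => [|N IH] c /=; first by ring.
pose S f := sum_words N f.
(* The cross term of both squares; it is the same on both sides by adjunction. *)
pose X := S (fun w => lower j (fun v => c (j.+1 :: v)) w * c (j :: w)).
pose A a := S (fun w => lower j (fun v => c (a :: v)) w ^+ 2).
pose B a := S (fun w => raise j (fun v => c (a :: v)) w ^+ 2).
pose n a := S (fun w => c (a :: w) ^+ 2).
transitivity (\sum_(a < k) A a + (2 * X + n j)).
  pose F a := 2 * S (fun w => lower j (fun v => c (a :: v)) w * c (j :: w)) + n j.
  rewrite -[X in _ = _ + X]/(F j.+1) -(sum_ord_delta F jk) -big_split.
  apply: eq_bigr => a _ /=; case: ifP => _.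
    rewrite /F /A /n /S -sum_wordsZ -!sum_wordsD.
    by apply: eq_sum_words => w; ring.
  by rewrite addr0; apply: eq_sum_words => w; rewrite addr0.
have -> : \sum_(a < k) sum_words N (fun w =>
     (raise j (fun v => c (val a :: v)) w
       + (if val a == j then c (j.+1 :: w) else 0)) ^+ 2)
   = \sum_(a < k) B a + (2 * X + n j.+1).
  pose F a := 2 * S (fun w => c (j.+1 :: w) * raise j (fun v => c (a :: v)) w) + n j.+1.
  have -> : 2 * X + n j.+1 = F j by rewrite /F /X /S lower_adjoint.
  rewrite -(sum_ord_delta F (ltnW jk)) -big_split.
  apply: eq_bigr => a _ /=; case: ifP => _.
    rewrite /F /B /n /S -sum_wordsZ -!sum_wordsD.
    by apply: eq_sum_words => w; ring.
  by rewrite addr0; apply: eq_sum_words => w; rewrite addr0.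
pose C a := S (fun w => ((count_mem j w)%:R - (count_mem j.+1 w)%:R) * c (a :: w) ^+ 2).
have -> : \sum_(a < k) sum_words N (fun w =>
      (((val a == j) + count_mem j w)%:R - ((val a == j.+1) + count_mem j.+1 w)%:R)
        * c (val a :: w) ^+ 2)
   = \sum_(a < k) C a + (n j - n j.+1).
  rewrite -(sum_ord_delta n (ltnW jk)) -(sum_ord_delta n jk) -sumrB -big_split.
  apply: eq_bigr => a _ /=.
  rewrite /C /n /S -!sum_words_if -mulN1r -sum_wordsZ -!sum_wordsD.
  by apply: eq_sum_words => w; rewrite !natrD; do 2!case: ifP => _ /=; ring.
have -> : \sum_(a < k) A a = \sum_(a < k) B a + \sum_(a < k) C a.
  by rewrite -big_split; apply: eq_bigr => a _; apply: IH.
ring.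
Qed.

Definition has_weight N l c :=
  forall w, is_word N w -> c w != 0 -> forall i, (i < k)%N -> count_mem i w = l i.

Definition highest N c :=
  forall j w, (j.+1 < k)%N -> is_word N w -> lower j c w = 0.

Lemma sum_words_eq N f1 f2 : (forall w, is_word N w -> f1 w = f2 w) ->
  sum_words N f1 = sum_words N f2.
Proof.
elim: N f1 f2 => [|N IH] f1 f2 e /=; first exact: e.
apply: eq_bigr => a _; apply: IH => w /andP[sw aw]; apply: e.
by rewrite /is_word /= eqSS sw ltn_ord.
Qed.

(** When [lower j c = 0], the norm identity writes [0] as a sum of squares plus
    a positive multiple of the squared norm of [c]. *)
Lemma highest_not_dominant N l c j : (j.+1 < k)%N -> (l j.+1 < l j)%N ->
  highest N c -> has_weight N l c -> forall w, is_word N w -> c w = 0.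
Proof.
move=> jk lj hc wc w Nw.
have := lower_raise_norm N c jk.
rewrite (@sum_words_eq N _ (fun=> 0 * 0)); last first.
  by move=> v Nv; rewrite hc // expr2.
rewrite sum_wordsZ mul0r.
rewrite (@sum_words_eq N (fun w => _ * c w ^+ 2)
   (fun w => ((l j)%:R - (l j.+1)%:R) * c w ^+ 2)); last first.
  move=> v Nv; have [->|cv] := eqVneq (c v) 0; first by rewrite expr2 !mulr0.
  by rewrite !(wc v) // ltnW.
rewrite sum_wordsZ => /esym/eqP.
have lt0 : 0 < (l j)%:R - (l j.+1)%:R :> R by rewrite subr_gt0 ltr_nat.
have s1 : 0 <= sum_words N (fun w => raise j c w ^+ 2).
  by apply: sum_words_ge0 => v; apply: sqr_ge0.
have s2 : 0 <= sum_words N (fun w => c w ^+ 2).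
  by apply: sum_words_ge0 => v; apply: sqr_ge0.
rewrite paddr_eq0 // ?(mulr_ge0 (ltW lt0)) // => /andP[_].
rewrite mulf_eq0 gt_eqF //= => /eqP s0.
have := sum_words_eq0 (fun w => sqr_ge0 (c w)) s0 Nw.
by move/eqP; rewrite sqrf_eq0 => /eqP.
Qed.

(** The operators [lower j] turn small letters into large ones as maps on basis
    vectors, so that a vector killed by all of them is extremal for the order in
    which larger letters are higher; dominant weights are nondecreasing. *)
Definition dominant l := all (fun j => (l j <= l j.+1)%N) (iota 0 k.-1).

Definition decr_weight i l := fun m => (l m - (m == i))%N.

(** When the entries of [l] sum to [N], these are the words of weight [l] all of
    whose suffixes have dominant weight, which are in bijection with the
    standard Young tableaux whose row lengths are the entries of [l]. *)
Fixpoint lattice_words N l : seq (seq nat) :=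
  if N is N'.+1 then
    if dominant l then
      flatten [seq [seq a :: w | w <- lattice_words N' (decr_weight a l)]
              | a <- [seq a <- iota 0 k | 0 < l a]]%N
    else [::]
  else [:: [::]].

(** The slices of [c] by the first letter are visited in increasing order of
    this letter.  Once the slices at smaller letters vanish, the slice at [a] is
    itself a highest weight vector, of weight [l] minus one [a]; so induction
    applies to it, and its lattice words prefixed by [a] are lattice words. *)
Lemma highest_determined N l c : highest N c -> has_weight N l c ->
  (forall w, w \in lattice_words N l -> c w = 0) ->
  forall w, is_word N w -> c w = 0.
Proof.
elim: N l c => [|N IH] l c hc wc c0 w Nw.
  by case/andP: Nw => /nilP -> _; apply: c0; rewrite inE.
have [dl|/allPn[j]] := boolP (dominant l); last first.
  rewrite mem_iota add0n -ltnNge => /andP[_ jk] lj.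
  by apply: (highest_not_dominant _ lj hc wc Nw); case: (k) jk.
suff H a v : (a < k)%N -> is_word N v -> c (a :: v) = 0.
  by case: w Nw => [|a w] //= /andP[sw /= /andP[ak aw]]; apply: H => //; apply/andP.
elim/ltn_ind: a v => a IHa v ak Nv.
have cons_word u : is_word N u -> is_word N.+1 (a :: u).
  by case/andP => su au; rewrite /is_word /= eqSS su ak.
have [la|la] := posnP (l a).
  apply/eqP; apply: contraT => cv.
  by have := wc _ (cons_word _ Nv) cv a ak; rewrite la /= eqxx.
apply: (IH (decr_weight a l) (fun v => c (a :: v))) => //.
- move=> j u jk Nu; have := hc j (a :: u) jk (cons_word _ Nu).
  rewrite /=; case: eqP => [aj|_]; last by rewrite addr0.
  by rewrite (IHa j) ?addr0 ?aj // ltnW.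
- move=> u Nu cu i ik; rewrite /decr_weight -(wc _ (cons_word _ Nu) cu i ik) /=.
  by rewrite [(a == i)]eq_sym addKn.
- move=> u lu; apply: c0 => /=; rewrite dl; apply/flatten_mapP; exists a.
    by rewrite mem_filter la mem_iota.
  exact: map_f.
Qed.

End HighestWeight.

(** * Counting lattice words *)

Section CountLatticeWords.
Variables (R : realFieldType) (k : nat).
Implicit Types (l L : nat -> nat).

(** The entry is [1 / (L i - j)!], read as [0] when [L i < j]. *)
Definition inv_fact_mx L : 'M[R]_k :=
  \matrix_(i < k, j < k) (((L i) ^_ j)%:R / ((L i)`!)%:R).

(** In the Leibniz expansion, the term of the permutation [s] is multiplied by
    [\sum_i (p i - q (s i))], which does not depend on [s]. *)
Lemma sum_det_scale_row (M : 'M[R]_k) (p q : 'I_k -> R) :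
  \sum_i \det (\matrix_(i', j) ((if i' == i then p i - q j else 1) * M i' j)) =
  (\sum_i p i - \sum_i q i) * \det M.
Proof.
rewrite exchange_big /= mulr_sumr; apply: eq_bigr => s _.
rewrite -mulr_sumr mulrCA; congr (_ * _).
transitivity (\sum_i (p i - q (s i)) * \prod_i' M i' (s i')); last first.
  rewrite -!mulr_suml !sumrB; congr ((_ - _) * _).
  by rewrite [RHS](reindex_inj (@perm_inj _ s)).
apply: eq_bigr => i _; rewrite (bigD1 i) //= [in RHS](bigD1 i) //= mulrA.
rewrite mxE eqxx; congr (_ * _); apply: eq_bigr => i' /negPf ne.
by rewrite mxE ne mul1r.
Qed.

Lemma inv_fact_pred (n j : nat) : (0 < n)%N ->
  ((n.-1 ^_ j)%:R / (n.-1`!)%:R : R) = (n%:R - j%:R) * ((n ^_ j)%:R / (n`!)%:R).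
Proof.
case: n => // n _ /=.
have nz m : (m`!)%:R != 0 :> R by rewrite pnatr_eq0 -lt0n fact_gt0.
apply/eqP; rewrite mulrA eqr_div // factS natrM mulrA; apply/eqP; congr (_ * _).
rewrite mulrC -natrM -ffactSS ffactnSr natrM mulrC.
have [jn|jn] := leqP j n.+1; first by rewrite natrB.
by rewrite ffact_small // mulr0 mulr0.
Qed.

(** Removing the letter [i] lowers [L i] by one, which by [inv_fact_pred] scales
    the entry [(i, j)] by [L i - j]; summing over [i] gives the factor
    [\sum_i (L i - i) = N] by [sum_det_scale_row].  The weights are allowed to
    fail to be dominant by one, because these are the weights reached by
    removing a letter from a dominant one; there [L] takes the same value twice
    and the determinant vanishes, while the set of lattice words is empty. *)
Lemma size_lattice_words N l :
  (forall i, (i.+1 < k)%N -> (l i <= (l i.+1).+1)%N) -> (\sum_(i < k) l i = N)%N ->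
  (size (lattice_words k N l))%:R = (N`!)%:R * \det (inv_fact_mx (fun i => l i + i)%N).
Proof.
elim: N l => [|N IH] l ld sl.
  have l0 (i : 'I_k) : l i = 0%N.
    by apply/eqP; move/eqP: sl; rewrite sum_nat_eq0 => /forallP/(_ i).
  rewrite mul1r det_trig /=.
    rewrite big1 // => i _; rewrite mxE l0 add0n ffactnn.
    by rewrite divff // pnatr_eq0 -lt0n fact_gt0.
  by apply/is_trig_mxP => i j ij; rewrite mxE l0 ffact_small // mul0r.
rewrite /=; case: ifP => [dl|/negbT/allPn[j]]; last first.
  rewrite mem_iota add0n -ltnNge => /andP[_ jk] lj.
  have jk1 : (j.+1 < k)%N by case: (k) jk.
  have e : (l j + j = l j.+1 + j.+1)%N by have := ld j jk1; lia.
  have ne : Ordinal (ltnW jk1) != Ordinal jk1.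
    by apply/eqP => /(congr1 val)/= /eqP; rewrite (ltn_eqF (ltnSn j)).
  rewrite (determinant_alternate ne) ?mulr0 // => i.
  by rewrite !mxE /= e.
rewrite size_flatten /shape -map_comp sumnE big_map big_filter.
have -> : iota 0 k = index_iota 0 k by rewrite /index_iota subn0.
rewrite big_mkord natr_sum.
have ldom i : (i.+1 < k)%N -> (l i <= l i.+1)%N.
  by move=> ik; apply: (allP dl); rewrite mem_iota; case: (k) ik.
pose L i := (l i + i)%N.
have -> : N.+1`!%:R = N`!%:R * (\sum_(i < k) (L i)%:R - \sum_(i < k) (val i)%:R) :> R.
  by rewrite -sumrB factS mulnC natrM -sl natr_sum; congr (_ * _);
     apply: eq_bigr => i _; rewrite natrD addrK.
rewrite -mulrA -sum_det_scale_row mulr_sumr big_mkcond /=.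
apply: eq_bigr => i _; case: posnP => [li|li] /=.
  (* When the letter [i] is exhausted, the scaled row is zero if [i = 0], and
     otherwise equals the row [i.-1], because [l i.-1 = 0] by dominance. *)
  have [i0|i0] := posnP i.
    rewrite (expand_det_row _ i) big1 ?mulr0 // => j _.
    rewrite !mxE eqxx /L li i0 !addn0 /=; case: (val j) => [|n].
      by rewrite subrr !mul0r.
    by rewrite ffact_small // !mul0r mulr0 mul0r.
  have ik : (i.-1 < k)%N by apply: leq_ltn_trans (ltn_ord i); apply: leq_pred.
  have li1 : l i.-1 = 0%N.
    by have := ldom i.-1; rewrite prednK // li leqn0 => /(_ (ltn_ord i))/eqP.
  have ne : Ordinal ik != i.
    by apply/eqP => /(congr1 val)/= /eqP; rewrite ltn_eqF // prednK.
  rewrite (determinant_alternate ne) ?mulr0 // => j.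
  rewrite !mxE eqxx (negPf ne) mul1r /L /= li li1 !add0n.
  by rewrite inv_fact_pred.
have Ldecr (i' : 'I_k) :
    (decr_weight i l i' + i' = if i' == i then (L i).-1 else L i')%N.
  rewrite /decr_weight /L; have [->|ne] := eqVneq i' i; first by rewrite eqxx; lia.
  by have -> : (nat_of_ord i' == i) = false; [exact: negPf ne|rewrite subn0].
rewrite size_map IH; last first.
- have := sl; rewrite (bigD1 i) //= [in X in _ -> X](bigD1 i) //=.
  rewrite [X in _ -> (_ + X)%N = N](eq_bigr (fun i' : 'I_k => l i')); last first.
    move=> i' /negPf ne; rewrite /decr_weight.
    by have -> : (nat_of_ord i' == i) = false; [exact: ne|rewrite subn0].
  rewrite /decr_weight eqxx; lia.
- by move=> m /ldom; rewrite /decr_weight; lia.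
congr (_ * \det _); apply/matrixP => i' j; rewrite !mxE Ldecr.
case: eqP => [->|_]; last by rewrite mul1r.
by rewrite inv_fact_pred // /L addn_gt0 li.
Qed.

(** [(m + i) ^_ j = j! 'C(m + i, j)], and by Vandermonde convolution the matrix
    of binomials is the product of the unitriangular matrices ['C(i, u)] and
    ['C(m, j - u)]. *)
Lemma det_inv_fact_rect (m : nat) :
  \det (inv_fact_mx (fun i => m + i)%N) = \prod_(i < k) ((i`!)%:R / ((m + i)`!)%:R).
Proof.
pose A : 'M[R]_k := \matrix_(i, j) ('C(i, j)%:R / ((m + i)`!)%:R).
pose B : 'M[R]_k :=
  \matrix_(i, j) ((if i <= j then 'C(m, j - i) else 0)%N%:R * (j`!)%:R).
have -> : inv_fact_mx (fun i => m + i)%N = A *m B.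
  apply/matrixP => i j; rewrite !mxE -bin_ffact addnC -binomial.Vandermonde.
  rewrite (big_ord_widen k (fun u => 'C(i, u) * 'C(m, j - u))%N (ltn_ord j)).
  rewrite natrM natr_sum big_mkcond !mulr_suml; apply: eq_bigr => u _.
  rewrite !mxE ltnS addnC; case: ifP => _; last by rewrite !(mul0r, mulr0).
  by rewrite natrM; ring.
rewrite det_mulmx det_trig; last first.
  by apply/is_trig_mxP => i j ij; rewrite mxE bin_small // mul0r.
rewrite -[\det B]det_tr det_trig; last first.
  by apply/is_trig_mxP => i j ij; rewrite !mxE leqNgt ij mul0r.
rewrite -big_split; apply: eq_bigr => i _ /=.
by rewrite !mxE binn leqnn subnn bin0; ring.
Qed.

End CountLatticeWords.

(** * Maximal minors *)

Section Minors.
Variables (R : comNzRingType) (k n : nat).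

Lemma det_mulmx_expand (A : 'M[R]_(k, n)) (B : 'M[R]_(n, k)) :
  \det (A *m B) =
  \sum_(r : {ffun 'I_k -> 'I_n}) (\prod_i A i (r i)) * \det (rowsub r B).
Proof.
pose F (s : 'S_k) (r : {ffun 'I_k -> 'I_n}) := \prod_i (A i (r i) * B (r i) (s i)).
transitivity (\sum_(s : 'S_k) (-1) ^+ s * \sum_r F s r).
  apply: eq_bigr => s _; congr (_ * _); rewrite -(bigA_distr_bigA
    (fun i l => A i l * B l (s i))) /=.
  by apply: eq_bigr => i _; rewrite mxE.
under eq_bigr do rewrite mulr_sumr.
rewrite exchange_big /=; apply: eq_bigr => r _; rewrite mulr_sumr.
apply: eq_bigr => s _; rewrite /F big_split mulrCA /=; congr (_ * (_ * _)).
by apply: eq_bigr => i _; rewrite !mxE.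
Qed.

(** The sum runs over all maps [r] instead of increasing ones, whence the factor
    [k`!].  Each of the [k`!] terms of [\det (rowsub r A)] contributes the same
    amount: its permutation can be moved to [r], and [\det (rowsub r B)] absorbs
    the sign. *)
Lemma cauchy_binet (A B : 'M[R]_(n, k)) :
  \sum_(r : {ffun 'I_k -> 'I_n}) \det (rowsub r A) * \det (rowsub r B) =
  (k`!)%:R * \det (A^T *m B).
Proof.
pose F (s : 'S_k) (r : {ffun 'I_k -> 'I_n}) :=
  (-1) ^+ s * (\prod_i A (r (s i)) i) * \det (rowsub r B).
transitivity (\sum_(s : 'S_k) \sum_r F s r).
  rewrite exchange_big; apply: eq_bigr => r _.
  rewrite -[\det (rowsub r A)]det_tr mulr_suml; apply: eq_bigr => s _.
  by congr (_ * _ * _); apply: eq_bigr => i _; rewrite !mxE.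
rewrite (eq_bigr (fun=> \det (A^T *m B))) => [|s _].
  by rewrite sumr_const card_Sn mulr_natl.
rewrite det_mulmx_expand.
pose h (u : 'S_k) (r : {ffun 'I_k -> 'I_n}) := [ffun i => r (u i)].
have hK u : cancel (h u) (h u^-1)%g.
  by move=> r; apply/ffunP => i; rewrite !ffunE permKV.
rewrite (reindex (h s^-1)%g); last first.
  by exists (h s) => r _; [have := hK s^-1%g r; rewrite invgK|apply: hK].
apply: eq_bigr => r _; rewrite /F.
have -> : rowsub (h s^-1 r)%g B = row_perm s^-1 (rowsub r B).
  by apply/matrixP => i j; rewrite !mxE ffunE.
rewrite row_permE det_mulmx det_perm odd_permV mulrACA -signr_addb addbb mul1r.
by congr (_ * _); apply: eq_bigr => i _; rewrite !mxE ffunE permK.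
Qed.

End Minors.

(** * Tensors as functions on maps of positions to letters *)

Definition permute N T (r : {ffun 'I_N -> T}) (u : 'S_N) : {ffun 'I_N -> T} :=
  [ffun p => r (u p)].

Definition subst N T (r : {ffun 'I_N -> T}) (p : 'I_N) (x : T) : {ffun 'I_N -> T} :=
  [ffun q => if q == p then x else r q].

Section Tensors.
Variables (R : realFieldType) (k N : nat).
Implicit Types (c : {ffun 'I_N -> 'I_k.+1} -> R).

Definition word_fun (s : seq nat) : {ffun 'I_N -> 'I_k.+1} :=
  [ffun p => inord (nth 0%N s (val p))].

Lemma lower_sum_nth j (c : seq nat -> R) w :
  lower j c w =
  \sum_(p < size w | nth 0%N w p == j.+1) c (set_nth 0%N w p j).
Proof.
elim: w c => [|a w IH] c /=; first by rewrite big_ord0.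
rewrite big_mkcond big_ord_recl /= IH addrC; congr (_ + _).
by rewrite [LHS]big_mkcond.
Qed.

(** [highest_determined] for tensors that are functions on maps from positions
    to letters, the form in which permutations of the positions are easy. *)
Lemma tensor_determined c m :
  (forall x y (w : {ffun 'I_N -> 'I_k.+1}), x != y ->
     \sum_(p | w p == y) c (subst w p x) = 0) ->
  (forall (w : {ffun 'I_N -> 'I_k.+1}) x, c w != 0 -> (\sum_(p | w p == x) 1 = m)%N) ->
  (forall s, s \in lattice_words k.+1 N (fun=> m) -> c (word_fun s) = 0) ->
  forall w, c w = 0.
Proof.
move=> hc wc c0 w.
have wordP s (p : 'I_N) : is_word k.+1 N s ->
    (nth 0%N s p < k.+1)%N /\ val (word_fun s p) = nth 0%N s p.
  case/andP => /eqP ss /all_nthP as_.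
  by have lt := as_ 0%N p; rewrite ss in lt; rewrite ffunE /= inordK lt.
pose s := [seq val (w p) | p <- enum 'I_N].
have Ns : is_word k.+1 N s.
  rewrite /is_word size_map size_enum_ord eqxx /=.
  by rewrite /s all_map; apply/allP => p _ /=.
have <- : word_fun s = w.
  apply/ffunP => p; apply: val_inj; rewrite (wordP _ _ Ns).2.
  by rewrite (nth_map p) ?size_enum_ord // nth_ord_enum.
apply: (highest_determined (c := fun s => c (word_fun s)) _ _ c0) => //.
- move=> j v jk Nv; have sv : size v = N by case/andP: Nv => /eqP.
  pose x : 'I_k.+1 := Ordinal (ltnW jk); pose y := Ordinal jk.
  have xy : x != y by rewrite -val_eqE /= neq_ltn ltnSn.
  rewrite lower_sum_nth -[RHS](hc x y (word_fun v) xy) sv.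
  apply: eq_big => p; first by rewrite -val_eqE (wordP _ _ Nv).2.
  move=> vp; congr c; apply/ffunP => q; rewrite !ffunE nth_set_nth /= val_eqE.
  by case: ifP => // _; apply: val_inj; rewrite /= inordK // ltnW.
- move=> v Nv cv i ik; rewrite -(wc _ (Ordinal ik) cv).
  have sv : size v = N by case/andP: Nv => /eqP.
  rewrite -sum1_count (big_nth 0%N) big_mkord sv.
  by apply: eq_bigl => p; rewrite -val_eqE (wordP _ _ Nv).2.
Qed.

End Tensors.

(** * Products of minors as multilinear forms in the rows *)

Section MinorProducts.
Variables (R : realFieldType) (beta : finType) (k : nat).
Local Notation N := #|{: beta * 'I_k}|.

(** The [N] positions are grouped into blocks of size [k], one for each
    [b : beta]; [block r b] is the restriction of [r] to the block [b]. *)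
Definition block T (r : {ffun 'I_N -> T}) (b : beta) : {ffun 'I_k -> T} :=
  [ffun i => r (enum_rank (b, i))].

Definition minor_prod n (U : 'M[R]_(n, k)) (r : {ffun 'I_N -> 'I_n}) : R :=
  \prod_b \det (rowsub (block r b) U).

Lemma big_blocks T (idx : T) (op : Monoid.com_law idx) (F : 'I_N -> T) :
  \big[op/idx]_p F p =
  \big[op/idx]_b \big[op/idx]_i F (enum_rank (b, i)).
Proof.
rewrite (reindex _ (onW_bij _ (enum_rank_bij {: beta * 'I_k}))) /=.
by rewrite pair_bigA; apply: eq_bigr => [[]].
Qed.

Lemma distr_blocks (T : finType) (F : beta -> {ffun 'I_k -> T} -> R) :
  \prod_b \sum_v F b v = \sum_(w : {ffun 'I_N -> T}) \prod_b F b (block w b).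
Proof.
rewrite bigA_distr_bigA /=.
pose h (w : {ffun 'I_N -> T}) := [ffun b => block w b].
pose g (v : {ffun beta -> {ffun 'I_k -> T}}) : {ffun 'I_N -> T} :=
  [ffun p => v (enum_val p).1 (enum_val p).2].
rewrite (reindex h); last first.
  exists g => v _.
    by apply/ffunP => p; rewrite !ffunE -surjective_pairing enum_valK.
  by apply/ffunP => b; apply/ffunP => i; rewrite !ffunE enum_rankK.
by apply: eq_bigr => w _; apply: eq_bigr => b _; rewrite ffunE.
Qed.

(** The coefficient of the word [w] is itself a product of minors, that of the
    identity matrix at [w]: each block contributes the sign of [block w b] if
    this is a permutation, and [0] otherwise. *)
Lemma minor_prod_expand n (U : 'M[R]_(n, k)) r :
  minor_prod U r =
  \sum_(w : {ffun 'I_N -> 'I_k}) minor_prod 1%:M w * \prod_p U (r p) (w p).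
Proof.
pose F b (v : {ffun 'I_k -> 'I_k}) :=
  (\prod_i U (block r b i) (v i)) * \det (rowsub v (1%:M : 'M[R]_k)).
transitivity (\prod_b \sum_v F b v).
  apply: eq_bigr => b _; rewrite -[rowsub _ _]mulmx1 det_mulmx_expand.
  by apply: eq_bigr => v _; congr (_ * _); apply: eq_bigr => i _; rewrite mxE.
rewrite distr_blocks; apply: eq_bigr => w _.
rewrite big_split mulrC big_blocks; congr (_ * _).
by apply: eq_bigr => b _; apply: eq_bigr => i _; rewrite !ffunE.
Qed.

Lemma block_subst (w : {ffun 'I_N -> 'I_k}) b i x b' :
  block (subst w (enum_rank (b, i)) x) b' =
  if b' == b then [ffun i' => if i' == i then x else block w b i'] else block w b'.
Proof.
case: eqVneq => [->|ne]; apply/ffunP => i'; rewrite !ffunE.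
  by rewrite (inj_eq enum_rank_inj) xpair_eqE eqxx.
by rewrite (inj_eq enum_rank_inj) xpair_eqE (negPf ne).
Qed.

(** The sum is the Laplace expansion, along column [x], of the determinant of a
    matrix whose columns [x] and [y] are equal. *)
Lemma sum_det_subst (v : {ffun 'I_k -> 'I_k}) (x y : 'I_k) : x != y ->
  \sum_(i | v i == y)
    \det (rowsub [ffun i' => if i' == i then x else v i'] (1%:M : 'M[R]_k)) = 0.
Proof.
move=> xy; pose M := rowsub v (1%:M : 'M[R]_k).
transitivity ((\adj M *m M) x y); last by rewrite mul_adj_mx !mxE (negPf xy).
rewrite [RHS]mxE big_mkcond; apply: eq_bigr => i _; rewrite !mxE.
have [_|_] := eqVneq (v i) y; last by rewrite mulr0.
rewrite mulr1 (expand_det_row _ i) (bigD1 x) //= big1 ?addr0 => [|j jx].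
  rewrite !mxE ffunE !eqxx mul1r /cofactor; congr (_ * \det _).
  apply/matrixP => i' j'; rewrite !mxE ffunE.
  by have /negPf -> : lift i i' != i by rewrite eq_sym neq_lift.
by rewrite !mxE ffunE eqxx eq_sym (negPf jx) mul0r.
Qed.

Lemma minor_prod_lower (w : {ffun 'I_N -> 'I_k}) (x y : 'I_k) : x != y ->
  \sum_(p | w p == y) minor_prod 1%:M (subst w p x) = 0.
Proof.
move=> xy; rewrite big_mkcond big_blocks /=.
apply: big1 => b _; rewrite -big_mkcond /=.
rewrite (eq_bigr (fun i =>
  \det (rowsub [ffun i' => if i' == i then x else block w b i'] (1%:M : 'M[R]_k)) *
  \prod_(b' | b' != b) \det (rowsub (block w b') 1%:M))); last first.
  move=> i _; rewrite /minor_prod (bigD1 b) //= block_subst eqxx.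
  by congr (_ * _); apply: eq_bigr => b' /negPf ne; rewrite block_subst ne.
rewrite -mulr_suml (eq_bigl (fun i => block w b i == y)) => [|i]; last by rewrite ffunE.
by rewrite sum_det_subst // mul0r.
Qed.

(** If the product is nonzero, each block of [w] is a permutation of the letters
    and contains [x] once. *)
Lemma minor_prod_weight (w : {ffun 'I_N -> 'I_k}) (x : 'I_k) :
  minor_prod 1%:M w != 0 -> (\sum_(p | w p == x) 1 = #|beta|)%N.
Proof.
move=> /prodf_neq0 w0; rewrite big_mkcond big_blocks /=.
rewrite -sum1_card; apply: eq_bigr => b _; rewrite -big_mkcond /=.
have injb : injective (block w b).
  move=> i i' e; apply/eqP; apply: contraTT (w0 b isT) => ne; rewrite negbK.
  by apply/eqP/(determinant_alternate ne) => j; rewrite !mxE e.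
have [g gK Kg] := injF_bij injb.
rewrite (big_pred1 (g x)) // => i /=.
have -> : w (enum_rank (b, i)) = block w b i by rewrite ffunE.
by rewrite -[RHS](inj_eq injb) Kg.
Qed.

End MinorProducts.

(** * The dimension bound *)

Lemma linear_dependency (F : fieldType) (I J : finType) (A : I -> J -> F) :
  (#|J| < #|I|)%N ->
  exists2 x : I -> F, (exists i, x i != 0) & forall j, \sum_i x i * A i j = 0.
Proof.
move=> JI; pose M : 'M[F]_(#|I|, #|J|) := \matrix_(i, j) A (enum_val i) (enum_val j).
have : kermx M != 0.
  rewrite kermx_eq0 -row_leq_rank -ltnNge.
  exact: leq_ltn_trans (rank_leq_col M) JI.
case/rowV0Pn => v vM v0.
have [i vi] : exists i, v 0 i != 0 by apply/rV0Pn.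
exists (fun i => v 0 (enum_rank i)) => [|j].
  by exists (enum_val i); rewrite enum_valK.
have /matrixP/(_ 0 (enum_rank j)) : v *m M = 0 by apply/sub_kermxP.
rewrite mxE [RHS]mxE => vMj; rewrite -[RHS]vMj (reindex _ (onW_bij _ (enum_val_bij I))).
by apply: eq_bigr => i' _; rewrite mxE !enum_rankK enum_valK.
Qed.

Section RankBound.
Variables (R : realFieldType) (beta : finType) (k n : nat).
Local Notation N := #|{: beta * 'I_k.+1}|.
Implicit Types (Phi : {ffun 'I_N -> 'I_n.+1} -> R).

Definition sorted_tuples : {set N.-tuple 'I_n.+1} :=
  [set t : N.-tuple 'I_n.+1 | sorted leq [seq val i | i <- t]].

Lemma sorted_permute (r : {ffun 'I_N -> 'I_n.+1}) :
  exists2 t, t \in sorted_tuples & exists u, r = permute [ffun p => tnth t p] u.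
Proof.
pose e := relpre (val : 'I_n.+1 -> nat) leq.
pose r' := [tuple r p | p < N]; pose t := [tuple of sort e r'].
exists t.
  by rewrite inE sorted_map sort_sorted // => x y; apply: leq_total.
have /tuple_permP[u e'] : perm_eq r' t by rewrite perm_sym perm_sort.
exists u; apply/ffunP => p; rewrite !ffunE.
have -> : r p = tnth r' p by rewrite tnth_mktuple.
have -> : r' = [tuple tnth t (u i) | i < N] by apply/val_inj.
by rewrite tnth_mktuple.
Qed.

(** Summing the coefficients over the permutations of the positions makes
    them invariant under simultaneous permutations of rows and letters, so that
    the sorted [r] are enough to determine them. *)
Definition sym_coef Phi r (w : {ffun 'I_N -> 'I_k.+1}) : R :=
  \sum_u Phi (permute r u) * minor_prod 1%:M (permute w u).

Lemma permuteM T (r : {ffun 'I_N -> T}) u v :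
  permute (permute r u) v = permute r (v * u).
Proof. by apply/ffunP => p; rewrite !ffunE permM. Qed.

Lemma permute_bij T u : bijective (fun r : {ffun 'I_N -> T} => permute r u).
Proof.
by exists (fun r => permute r u^-1) => r; apply/ffunP => p;
   rewrite !ffunE ?permK ?permKV.
Qed.

Lemma sym_coef_permute Phi r w u :
  sym_coef Phi (permute r u) (permute w u) = sym_coef Phi r w.
Proof.
rewrite /sym_coef [RHS](reindex_inj (mulIg u)) /=.
by apply: eq_bigr => v _; rewrite !permuteM.
Qed.

Lemma sym_coef_lower Phi r (x y : 'I_k.+1) (w : {ffun 'I_N -> 'I_k.+1}) : x != y ->
  \sum_(p | w p == y) sym_coef Phi r (subst w p x) = 0.
Proof.
move=> xy; rewrite exchange_big big1 // => u _.
rewrite -mulr_sumr (reindex_inj (@perm_inj _ u)) /=.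
rewrite -[RHS](mulr0 (Phi (permute r u))); congr (_ * _).
rewrite -[RHS](minor_prod_lower R (permute w u) xy).
apply: eq_big => p; first by rewrite ffunE.
move=> _; congr minor_prod; apply/ffunP => q; rewrite !ffunE.
by rewrite (inj_eq perm_inj).
Qed.

Lemma sym_coef_weight Phi r (w : {ffun 'I_N -> 'I_k.+1}) x :
  sym_coef Phi r w != 0 -> (\sum_(p | w p == x) 1 = #|beta|)%N.
Proof.
move=> a0.
have [u] : exists u, minor_prod (1%:M : 'M[R]_k.+1) (permute w u) != 0.
  apply/existsP; apply: contraR a0 => /existsPn w0; rewrite /sym_coef big1 // => u _.
  by have := w0 u; rewrite negbK => /eqP ->; rewrite mulr0.
move/(minor_prod_weight x) => <-; rewrite (reindex_inj (@perm_inj _ u)).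
by apply: eq_bigl => p; rewrite ffunE.
Qed.

Lemma sum_sym_coef Phi (U : 'M[R]_(n.+1, k.+1)) :
  (N`!)%:R * \sum_r Phi r * minor_prod U r =
  \sum_r \sum_w sym_coef Phi r w * \prod_p U (r p) (w p).
Proof.
transitivity (\sum_(u : 'S_N) \sum_r \sum_w
   Phi (permute r u) * minor_prod 1%:M (permute w u) * \prod_p U (r p) (w p)).
  rewrite -card_Sn mulr_natl -sumr_const; apply: eq_bigr => u _.
  rewrite [LHS](reindex _ (onW_bij _ (permute_bij _ u))).
  apply: eq_bigr => r _; rewrite minor_prod_expand mulr_sumr.
  rewrite (reindex _ (onW_bij _ (permute_bij _ u))) /=.
  apply: eq_bigr => w _; rewrite mulrA; congr (_ * _).
  rewrite [RHS](reindex_inj (@perm_inj _ u)) /=.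
  by apply: eq_bigr => p _; rewrite !ffunE.
rewrite exchange_big; apply: eq_bigr => r _.
rewrite exchange_big; apply: eq_bigr => w _.
by rewrite -mulr_suml.
Qed.

(** At a sorted [r] the symmetrized coefficients form a highest weight vector,
    hence vanish with their values at lattice words; [sym_coef_permute] carries
    this to every [r]. *)
Lemma minor_prod_comb_eq0 Phi :
  (forall t s, t \in sorted_tuples -> s \in lattice_words k.+1 N (fun=> #|beta|) ->
     sym_coef Phi [ffun p => tnth t p] (word_fun k N s) = 0) ->
  forall U, \sum_r Phi r * minor_prod U r = 0.
Proof.
move=> a0 U.
have t0 t w : t \in sorted_tuples -> sym_coef Phi [ffun p => tnth t p] w = 0.
  move=> tS; apply: (tensor_determined (m := #|beta|)).
  - by move=> x y v; apply: sym_coef_lower.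
  - by move=> v x; apply: sym_coef_weight.
  - by move=> s; apply: a0.
have : N`!%:R * \sum_r Phi r * minor_prod U r = 0.
  rewrite sum_sym_coef big1 // => r _; rewrite big1 // => w _.
  have [t tS [u ->]] := sorted_permute r.
  have [g _ Kg] := permute_bij 'I_k.+1 u.
  by rewrite -(Kg w) sym_coef_permute t0 ?mul0r.
by move/eqP; rewrite mulf_eq0 pnatr_eq0 -leqn0 leqNgt fact_gt0 => /eqP.
Qed.

(** Were [I] larger than the number of pairs of a multiset of rows and a lattice
    word, some nontrivial combination of the forms would have zero symmetrized
    coefficients at all those pairs, and so would vanish as a function;
    evaluating it at [U i] isolates the coefficient of index [i]. *)
Lemma card_separated_points (I : finType) (Phi : I -> {ffun 'I_N -> 'I_n.+1} -> R)
    (U : I -> 'M[R]_(n.+1, k.+1)) :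
  (forall i j, i != j -> \sum_r Phi i r * minor_prod (U j) r = 0) ->
  (forall i, \sum_r Phi i r * minor_prod (U i) r != 0) ->
  (#|I| <= 'C(N + n, N) * size (lattice_words k.+1 N (fun=> #|beta|)))%N.
Proof.
move=> ne0 eq1; set L := lattice_words _ _ _.
rewrite leqNgt; apply/negP => lt.
pose J := ({t | t \in sorted_tuples} * 'I_(size L))%type.
have cJ : #|{: J}| = ('C(N + n, N) * size L)%N.
  by rewrite card_prod card_ord card_sig -card_sorted_tuples cardsE.
rewrite -cJ in lt.
pose A i (j : J) :=
  sym_coef (Phi i) [ffun p => tnth (val j.1) p] (word_fun k N (nth [::] L j.2)).
have [x [i xi] xA] := linear_dependency A lt.
pose P r := \sum_i x i * Phi i r.
have Pcoef r w : sym_coef P r w = \sum_i x i * sym_coef (Phi i) r w.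
  rewrite /sym_coef; under [RHS]eq_bigr do rewrite mulr_sumr.
  rewrite exchange_big; apply: eq_bigr => u _; rewrite mulr_suml.
  by apply: eq_bigr => i' _; rewrite mulrA.
have : \sum_r P r * minor_prod (U i) r = 0.
  apply: minor_prod_comb_eq0 => t s tS sL; rewrite Pcoef.
  have sz : (index s L < size L)%N by rewrite index_mem.
  have := xA (exist _ t tS, Ordinal sz); rewrite /A /= nth_index //.
have -> : \sum_r P r * minor_prod (U i) r =
    \sum_i' x i' * \sum_r Phi i' r * minor_prod (U i) r.
  under [RHS]eq_bigr do rewrite mulr_sumr.
  rewrite exchange_big; apply: eq_bigr => r _; rewrite mulr_suml.
  by apply: eq_bigr => i' _; rewrite mulrA.
rewrite (bigD1 i) //= [X in _ + X]big1 ?addr0 => [|i' ne]; last by rewrite ne0 ?mulr0.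
by move/eqP; rewrite mulf_eq0 (negPf xi) (negPf (eq1 i)).
Qed.

End RankBound.

(** * Plücker coordinates and the Fubini-Study distance *)

Section Plucker.
Variables (R : realFieldType) (k n : nat).
Implicit Types (A B : 'M[R]_(n, k)).

(** Cramer's rule: the coordinates of the row [i] of [A] in terms of the rows
    selected by [r] are quotients of minors. *)
Lemma mulmx_adj_minor A (r : {ffun 'I_k -> 'I_n}) i j :
  (A *m \adj (rowsub r A)) i j =
  \det (rowsub [ffun j' => if j' == j then i else r j'] A).
Proof.
rewrite mxE (expand_det_row _ j); apply: eq_bigr => l _.
rewrite !mxE ffunE eqxx /cofactor; congr (_ * (_ * \det _)).
apply/matrixP => a b; rewrite !mxE ffunE.
by have /negPf -> : lift j a != j by rewrite eq_sym neq_lift.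
Qed.

(** The frame normalized to be the identity on the rows [r0] is a function of
    the minors up to scale, by [mulmx_adj_minor]. *)
Lemma plucker_inj A B (e : R) (r0 : {ffun 'I_k -> 'I_n}) :
  (forall r : {ffun 'I_k -> 'I_n}, \det (rowsub r A) = e * \det (rowsub r B)) ->
  \det (rowsub r0 A) != 0 -> exists P, A = B *m P.
Proof.
move=> AB d0; pose M := rowsub r0 A.
exists (((\det M)^-1 * e) *: (\adj (rowsub r0 B) *m M)).
rewrite -scalemxAr mulmxA -scalerA scalemxAl.
have -> : e *: (B *m \adj (rowsub r0 B)) = A *m \adj M.
  by apply/matrixP => i j; rewrite mxE !mulmx_adj_minor AB.
rewrite -mulmxA mul_adj_mx mul_mx_scalar scalerA mulVf ?scale1r //.
Qed.

Lemma sum_sqr_minors A B (e : R) : A^T *m A = 1%:M -> B^T *m B = 1%:M ->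
  \sum_(r : {ffun 'I_k -> 'I_n}) (\det (rowsub r A) - e * \det (rowsub r B)) ^+ 2 =
  (k`!)%:R * (1 + e ^+ 2 - 2 * e * \det (A^T *m B)).
Proof.
move=> AA BB; have := cauchy_binet A A; have := cauchy_binet A B.
have := cauchy_binet B B; rewrite AA BB !det1 !mulr1 => bb ab aa.
transitivity (\sum_(r : {ffun 'I_k -> 'I_n})
   (\det (rowsub r A) * \det (rowsub r A) +
    e ^+ 2 * (\det (rowsub r B) * \det (rowsub r B)) -
    2 * e * (\det (rowsub r A) * \det (rowsub r B)))).
  by apply: eq_bigr => r _; ring.
by rewrite sumrB big_split -!mulr_sumr aa bb ab /=; ring.
Qed.

(** [sum_sqr_minors] at [e = 1] and [e = -1]: Cauchy-Schwarz. *)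
Lemma det_orthonormal_le1 A B : A^T *m A = 1%:M -> B^T *m B = 1%:M ->
  `|\det (A^T *m B)| <= 1.
Proof.
move=> AA BB.
have ge0 e : 0 <= (k`!)%:R * (1 + e ^+ 2 - 2 * e * \det (A^T *m B)).
  by rewrite -sum_sqr_minors //; apply: sumr_ge0 => r _; apply: sqr_ge0.
have k0 : 0 < (k`!)%:R :> R by rewrite ltr0n fact_gt0.
have := ge0 1; have := ge0 (-1); rewrite !pmulr_rge0 // ler_norml => *.
by apply/andP; split; lra.
Qed.

(** [sum_sqr_minors] at [e = \det (A^T *m B)]: the Plücker vectors agree up to
    sign. *)
Lemma det_orthonormal_eq1 A B : A^T *m A = 1%:M -> B^T *m B = 1%:M ->
  `|\det (A^T *m B)| = 1 -> exists P, A = B *m P.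
Proof.
move=> AA BB ab; pose e := \det (A^T *m B).
have ee : e ^+ 2 = 1 by rewrite -real_normK ?num_real // ab expr1n.
have := sum_sqr_minors e AA BB.
have -> : 1 + e ^+ 2 - 2 * e * \det (A^T *m B) = 0.
  by rewrite -/e -mulrA -expr2 ee; ring.
rewrite mulr0 => /eqP; rewrite psumr_eq0 => [/allP h|r _]; last exact: sqr_ge0.
have AB (r : {ffun 'I_k -> 'I_n}) : \det (rowsub r A) = e * \det (rowsub r B).
  have := h r (mem_index_enum r); rewrite /= sqrf_eq0.
  by rewrite subr_eq0 => /eqP.
have [r0 d0] : exists r0 : {ffun 'I_k -> 'I_n}, \det (rowsub r0 A) != 0.
  apply/existsP; apply: contraT => /existsPn d0.
  have := cauchy_binet A A; rewrite AA det1 mulr1 big1 => [/esym/eqP|r _].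
    by rewrite pnatr_eq0 -leqn0 leqNgt fact_gt0.
  by have := d0 r; rewrite negbK => /eqP ->; rewrite mul0r.
exact: plucker_inj AB d0.
Qed.

(** Using [\det (U^T U)] in place of the constant [1], its value at orthonormal
    frames, makes every factor a combination of products of two minors; each
    [i : 'I_s] then accounts for two blocks, indexed by [bool]. *)
Lemma annihilator_expand s (V : 'M[R]_(n, k)) (tau : 'I_s -> R) :
  exists Phi : {ffun 'I_#|{: 'I_s * bool * 'I_k}| -> 'I_n} -> R,
  forall U : 'M[R]_(n, k),
  \prod_i (\det (U^T *m V) ^+ 2 - tau i * \det (U^T *m U)) =
  \sum_r Phi r * minor_prod U r.
Proof.
pose T := {ffun 'I_k -> 'I_n}; pose c : R := (k`!)%:R^-1.
have cb (A B : 'M[R]_(n, k)) : \det (A^T *m B) =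
    c * \sum_(r : T) \det (rowsub r A) * \det (rowsub r B).
  by rewrite cauchy_binet mulKf // pnatr_eq0 -lt0n fact_gt0.
pose psi i (q : T * T) : R :=
  c ^+ 2 * (\det (rowsub q.1 V) * \det (rowsub q.2 V)) -
  (if q.1 == q.2 then tau i * c else 0).
pose rho_rows (rho : {ffun 'I_s -> T * T}) :
    {ffun 'I_#|{: 'I_s * bool * 'I_k}| -> 'I_n} :=
  [ffun p => let: (i, b, j) := enum_val p in
     (if b then (rho i).1 else (rho i).2) j].
exists (fun r => \sum_(rho | rho_rows rho == r) \prod_i psi i (rho i)) => U.
pose m (q : T * T) := \det (rowsub q.1 U) * \det (rowsub q.2 U).
transitivity (\prod_(i < s) \sum_q psi i q * m q).
  apply: eq_bigr => i _.
  rewrite (eq_bigr (fun q : T * T =>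
      c ^+ 2 * (\det (rowsub q.1 U) * \det (rowsub q.1 V))
        * (\det (rowsub q.2 U) * \det (rowsub q.2 V)) -
      (if q.2 == q.1 then tau i * c * m q else 0))); last first.
    by move=> q _; rewrite /psi /m eq_sym; case: ifP => _; ring.
  rewrite sumrB; congr (_ - _).
    rewrite cb exprMn [X in _ * X]expr2 big_distrlr /= pair_bigA mulr_sumr.
    by apply: eq_bigr => q _; rewrite mulrA.
  rewrite cb mulrA mulr_sumr.
  rewrite -(pair_bigA _ (fun q1 q2 =>
    if q2 == q1 then tau i * c * m (q1, q2) else 0)) /=.
  by apply: eq_bigr => q _; rewrite -big_mkcond big_pred1_eq.
rewrite bigA_distr_bigA /= (partition_big rho_rows predT) //=.
apply: eq_bigr => r _; rewrite mulr_suml; apply: eq_bigr => rho /eqP <-.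
rewrite big_split; congr (_ * _); rewrite /minor_prod.
transitivity (\prod_i \prod_b \det (rowsub (block (rho_rows rho) (i, b)) U));
  last by rewrite pair_bigA; apply: eq_bigr => [[]].
apply: eq_bigr => i _; rewrite big_bool /m /=; congr (_ * _); congr (\det _);
  by apply/matrixP => j l; rewrite !mxE !ffunE enum_rankK.
Qed.

End Plucker.

Section FubiniStudy.
Variables (R : realType) (k n : nat).
Implicit Types (U V : Gr R k n).

Lemma cos_dFS U V : cos (dFS U V) = `|\det ((onb U)^T *m onb V)|.
Proof.
have [_ UU] := onbP U; have [_ VV] := onbP V.
rewrite acosK // in_itv /= det_orthonormal_le1 // andbT.
by apply: le_trans (normr_ge0 _); rewrite oppr_le0.
Qed.

Lemma det_onb_eq1 U V : `|\det ((onb U)^T *m onb V)| = 1 -> U = V.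
Proof.
have [bU UU] := onbP U; have [bV VV] := onbP V.
move=> /(det_orthonormal_eq1 UU VV)[P e]; apply: val_inj; apply/eqP.
rewrite eqEdim (eqP (valP U)) (eqP (valP V)) leqnn andbT.
rewrite -(span_basis bU); apply/span_subvP => _ /mapP[i _ ->].
rewrite e colE -mulmxA mul_mx_col_sum memv_suml // => j _; rewrite memvZ //.
by apply: (basis_mem bV); apply/mapP; exists j; rewrite ?mem_enum.
Qed.

End FubiniStudy.

(** Both sides are products over a [k] by [m] rectangle of the inverse hook
    lengths, taken by rows and by columns. *)
Lemma prod_ratio_fact (F : numFieldType) (k m : nat) :
  \prod_(i < k) ((i`!)%:R / ((m + i)`!)%:R) =
  \prod_(1 <= j < m.+1) (((j - 1)`!)%:R / ((j + k - 1)`!)%:R) :> F.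
Proof.
have nz a : (a`!)%:R != 0 :> F by rewrite pnatr_eq0 -lt0n fact_gt0.
elim: m => [|m IH].
  by rewrite big_geq // big1 // => i _; rewrite add0n divff.
rewrite big_nat_recr //= -IH subSS subn0 addSn subSS subn0.
elim: k {IH} => [|k IH]; first by rewrite !big_ord0 addn0 divff // mulr1.
rewrite !big_ord_recr /= IH addnS addSn.
field.
by rewrite !nz.
Qed.

Lemma ffact_asymptotic (F : realFieldType) (N : nat) :
  exists2 K : F, 0 <= K & forall n,
  ((N.+1 + n) ^_ N.+1)%:R <= n.+1%:R ^+ N.+1 + K * n.+1%:R ^+ N.
Proof.
elim: N => [|N [K K0 IH]].
  by exists 0 => // n; rewrite ffactn1 mul0r addr0.
(* Expand [(x + N.+1) (x ^+ N.+1 + K x ^+ N)] and use [x ^+ N <= x ^+ N.+1]. *)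
exists (N.+1%:R * (1 + K) + K) => [|n].
  by rewrite addr_ge0 // mulr_ge0 // addr_ge0.
rewrite addSn ffactnS natrM /=; set x : F := n.+1%:R.
have x1 : 1 <= x by rewrite ler1n.
have -> : (N.+1 + n).+1%:R = x + N.+1%:R by rewrite -natrD; congr _%:R; lia.
apply: le_trans (_ : (x + N.+1%:R) * (x ^+ N.+1 + K * x ^+ N) <= _).
  by apply: ler_wpM2l; rewrite ?addr_ge0.
have : K * N.+1%:R * x ^+ N <= K * N.+1%:R * x ^+ N.+1.
  by apply: ler_wpM2l; [apply: mulr_ge0|apply: ler_weXn2l].
rewrite !exprS; nra.
Qed.

Lemma card_distance_set (R : realType) (k n s : nat) (S : {fset Gr R k.+1 n.+1}) :
  s_distance_set s (@dFS R k.+1 n.+1) S ->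
  (#|` S| <= 'C(2 * k.+1 * s + n, 2 * k.+1 * s) *
     size (lattice_words k.+1 (2 * k.+1 * s) (fun=> 2 * s)))%N.
Proof.
rewrite /s_distance_set; set D := (X in size (enum_fset X)) => sD.
pose taus := [seq cos d ^+ 2 | d <- D]; pose tau (i : 'I_s) := taus`_i.
have cos2 (U V : Gr R k.+1 n.+1) :
    cos (dFS U V) ^+ 2 = \det ((onb U)^T *m onb V) ^+ 2.
  by rewrite cos_dFS real_normK ?num_real.
(* Indices beyond the number of distances give the default value [0]. *)
have tau1 i : tau i != 1.
  have [lt|ge] := ltnP i (size taus); last first.
    by rewrite /tau nth_default // eq_sym oner_eq0.
  have /mapP[d dD ->] : tau i \in taus by apply: mem_nth.
  have /imfset2P[U _ [V]] := dD; rewrite !inE => /andP[_ UV] ->.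
  apply: contra_neq UV; rewrite cos_dFS => /eqP; rewrite sqrf_eq1 => /orP[]/eqP d1.
    exact: det_onb_eq1.
  by have := normr_ge0 (\det ((onb U)^T *m onb V)); rewrite d1 oppr_ge0 ler10.
have [Phi PhiE] :=
  boolp.choice (fun V : 'M[R]_(n.+1, k.+1) => annihilator_expand V tau).
have cb : #|{: 'I_s * bool}| = (2 * s)%N by rewrite card_prod card_ord card_bool mulnC.
have cN : #|{: 'I_s * bool * 'I_k.+1}| = (2 * k.+1 * s)%N.
  by rewrite card_prod cb card_ord mulnAC.
rewrite -cN -cb cardfE.
apply: (@card_separated_points R ('I_s * bool)%type k n S
  (fun V => Phi (onb (val V))) (fun U => onb (val U))).
- move=> V U VU; rewrite -PhiE.
  have dD : dFS (val U) (val V) \in D.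
    apply/imfset2P; exists (val U); first exact: valP.
    by exists (val V) => //; rewrite !inE fsvalP (inj_eq val_inj) eq_sym.
  have ct : cos (dFS (val U) (val V)) ^+ 2 \in taus by apply: map_f.
  have lt : (index (cos (dFS (val U) (val V)) ^+ 2) taus < s)%N.
    by have := index_mem (cos (dFS (val U) (val V)) ^+ 2) taus;
       rewrite ct size_map => /leq_trans; apply.
  apply/eqP/prodf_eq0; exists (Ordinal lt) => //.
  have [_ ->] := onbP (val U).
  by rewrite det1 mulr1 /tau nth_index // cos2 subrr.
- move=> V; rewrite -PhiE; apply/prodf_neq0 => i _.
  have [_ ->] := onbP (val V).
  by rewrite det1 expr1n mulr1 subr_eq0 eq_sym.
Qed.

Theorem theorem4p4 (R : realType) (k s : nat) (hk : (1 <= k)%N) (hs : (1 <= s)%N) :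
  exists K : R, 0 < K /\
    forall n : nat, (k <= n)%N ->
      (Nmax s (@dFS R k n) <=
        ((\prod_(1 <= j < (2 * s).+1) (((j - 1)`!)%:R / ((j + k - 1)`!)%:R))
           * n%:R ^+ (2 * k * s) + K * n%:R ^+ (2 * k * s - 1))%:E)%E.
Proof.
case: k hk => // k _; set N := (2 * k.+1 * s)%N.
have N0 : (0 < N)%N by rewrite !muln_gt0.
have [K0 K00 bound] := ffact_asymptotic R N.-1; rewrite (prednK N0) in bound.
set h := \prod_(_ <= _ < _) _.
have h0 : 0 <= h by apply: prodr_ge0 => j _; rewrite divr_ge0.
exists (h * K0 + 1); split; first by rewrite ltr_wpDl // mulr_ge0.
case=> [|n] // kn; apply: ge_ereal_sup => _ [S Sd <-]; rewrite lee_fin.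
have := card_distance_set Sd; rewrite -/N -(ler_nat R) => /le_trans; apply.
rewrite natrM size_lattice_words //; last first.
  by rewrite sum_nat_const card_ord /N; lia.
rewrite det_inv_fact_rect prod_ratio_fact -/h mulrA -natrM bin_ffact mulrC.
apply: le_trans (ler_wpM2l h0 (bound n)) _.
rewrite subn1 mulrDr mulrDl mul1r addrA mulrA lerDl.
exact: exprn_ge0.
Qed.
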